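(* (1) Let $(Y_0,Y_1)$ be an arbitrary pair of real random variables and let $Y$ and $D\in\{0,1\}$ satisfy $Y=Y_1D+Y_0(1-D)$ and almost surely $Y_1>Y_0\Rightarrow D=1$, $Y_1<Y_0\Rightarrow D=0$. Then the distribution functions $F_0,F_1$ of $Y_0,Y_1$ satisfy $$F_d(y_2)-F_d(y_1)\ge \mathbb P(y_1<Y\le y_2,D=d)+\mathbb P(Y\le y_2,D=1-d)\,1\{y_1=-\infty\}\qquad(\ast)$$ for $d=0,1$ and all $y_1,y_2\in\mathbb R\cup\{\pm\infty\}$ with $y_1<y_2$. (2) Conversely, let $Y$ be an arbitrary real random variable and $D$ a binary random variable, and let $F_0,F_1$ be right-continuous functions satisfying $(\ast)$ for $d=0,1$ and all $y_1<y_2$ in $\mathbb R\cup\{\pm\infty\}$. Then there exist, on some probability space, random variables $(\tilde Y,\tilde D,Y_0,Y_1)$ with $(\tilde Y,\tilde D)$ distributed as $(Y,D)$, $Y_0$ and $Y_1$ having distribution functions $F_0$ and $F_1$ respectively, $\tilde Y=Y_1\tilde D+Y_0(1-\tilde D)$, and almost surely $Y_1>Y_0\Rightarrow\tilde D=1$, $Y_1<Y_0\Rightarrow\tilde D=0$.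
   Context: For a function $F$ on $\mathbb R$, $F(\pm\infty)$ denotes the limits at $\pm\infty$; for $y_1=-\infty$ the event $\{y_1<Y\le y_2\}$ is $\{Y\le y_2\}$, and for $y_2=+\infty$ the event $\{Y\le y_2\}$ is the whole space.
   Formalization: In part (2) F_0 and F_1 are additionally assumed to tend to 0 at −∞ and to 1 at +∞; without this the claim fails (e.g. adding 5 to F_d preserves (∗) and right-continuity), and the conclusion forces it. *)

(* Defs.v *)
From HB Require Import structures.
From mathcomp Require Import all_boot all_order all_algebra.
From mathcomp Require Import all_classical all_reals all_analysis.
Set Implicit Arguments. Unset Strict Implicit. Unset Printing Implicit Defensive.
Import Order.TTheory GRing.Theory Num.Theory.
Import numFieldNormedType.Exports.
Local Open Scope classical_set_scope.
Local Open Scope ring_scope.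

Definition Fext (R : realType) (F : R -> \bar R) (y : \bar R) : \bar R :=
  match y with
  | EFin r => F r
  | +oo%E => lim (F x @[x --> +oo])
  | -oo%E => lim (F x @[x --> -oo])
  end.

(* The inequality (star) for a given d, F, and (Y, D) on (T, P), at (y1, y2):
   F(y2) - F(y1) >= P(y1 < Y <= y2, D = d) + P(Y <= y2, D = 1 - d) 1{y1 = -oo}.
   Events are written with extended reals, so that y1 = -oo gives {Y <= y2}
   and y2 = +oo gives no upper constraint. *)
Definition ineq_star d (T : measurableType d) (R : realType)
  (P : probability T R) (Y D : T -> R) (dd : R) (F : R -> \bar R)
  (y1 y2 : \bar R) : Prop :=
  (P [set x | (y1 < (Y x)%:E)%E /\ ((Y x)%:E <= y2)%E /\ D x = dd%R]
   + (y1 == -oo)%E%:R%:E * P [set x | ((Y x)%:E <= y2)%E /\ D x = (1 - dd)%R]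
   <= Fext F y2 - Fext F y1)%E.

(* Main.v *)
(* For (1), [Y = Y_d] on [D = d], and [Y_d <= Y] almost surely on [D = 1 - d], so
   the event on the left of (star) is almost surely contained in
   [y1 < Y_d <= y2].

   For (2), write [J_d y = P(Y <= y, D = d)] and [K_d = F_d - J_d]. Inequality
   (star) at finite points says that [K_d] is nondecreasing, i.e. that it is the
   distribution function of a measure of mass [P(D = 1 - d)], and (star) at
   [y1 = -oo] says that [J_(1 - d) <= K_d]. On the part of the unit interval that
   represents [D = 1 - d], take for [Y_(1 - d)] the quantile function of
   [J_(1 - d)] and for [Y_d] that of [K_d]: the quantile function decreases when
   the distribution function increases, whence [Y_d <= Y_(1 - d)] there, and
   the two parts add up to give [Y_d] the distribution function
   [J_d + K_d = F_d]. *)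
Require Import Defs.
From HB Require Import structures.
From mathcomp Require Import all_boot all_order all_algebra.
From mathcomp Require Import all_classical all_reals all_analysis.
Import Order.TTheory GRing.Theory Num.Theory.
Import numFieldNormedType.Exports.
Local Open Scope classical_set_scope.
Local Open Scope ring_scope.
From mathcomp Require Import measurable_realfun lra.
Set Implicit Arguments. Unset Strict Implicit. Unset Printing Implicit Defensive.

(** * Distribution functions of finite mass and their quantile functions *)

Definition mass_cdf (R : realType) (m : R) (G : R -> R) :=
  [/\ {homo G : x y / x <= y}, right_continuous G,
      G @ -oo --> (0 : R) & G @ +oo --> m].

(* The value outside of [`]0, m[] is junk; that it does not depend on [G] makes
   [quantile_anti] hold for every [u]. *)
Definition quantile (R : realType) (m : R) (G : R -> R) (u : R) :=
  if 0 < u < m then inf [set y | u <= G y] else 0.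

Section quantile.
Context {R : realType}.
Implicit Types (m a u y : R) (G : R -> R).

Lemma mass_cdf_ge0 {m G} y : mass_cdf m G -> 0 <= G y.
Proof.
case=> ndG _ G0 _; apply: (cvgr_to_le G0).
by near=> x; apply: ndG; near: x; apply: nbhs_ninfty_le; rewrite num_real.
Unshelve. all: by end_near. Qed.

Lemma mass_cdf_le {m G} y : mass_cdf m G -> G y <= m.
Proof.
case=> ndG _ _ Gm; apply: (cvgr_to_ge Gm).
by near=> x; apply: ndG; near: x; apply: nbhs_pinfty_ge; rewrite num_real.
Unshelve. all: by end_near. Qed.

(** The Galois connection behind all later facts on quantiles. The bounds [0 < u < m] make the set
    under the infimum nonempty and bounded below, and right continuity puts the infimum into the
    set. *)
Lemma quantile_le m G u y : mass_cdf m G -> 0 < u < m ->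
  (quantile m G u <= y) = (u <= G y).
Proof.
case=> ndG rcG G0 Gm u0m; rewrite /quantile u0m; case/andP: u0m => u0 um.
set E := [set z | u <= G z].
have E0 : E !=set0.
  have /filter_ex[z uz] : \forall x \near +oo, u <= G x by exact: cvgr_ge um.
  by exists z.
have [z0 Gz0] : exists z, G z < u.
  have /filter_ex[z uz] : \forall x \near -oo, G x < u by exact: cvgr_lt u0.
  by exists z.
have lbE : has_lbound E.
  exists z0 => z; rewrite /E/= => uz; rewrite leNgt; apply/negP => zz0.
  by move: (le_lt_trans uz (le_lt_trans (ndG _ _ (ltW zz0)) Gz0)); rewrite ltxx.
apply/idP/idP => [yE|uy]; last exact: ge_inf.
have : u <= G (inf E).
  apply: (cvgr_to_ge (rcG (inf E))); near=> x.
  have e0 : 0 < x - inf E by rewrite subr_gt0; near: x; exact: nbhs_right_gt.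
  have [z Ez zx] := inf_adherent e0 (conj E0 lbE).
  by apply: (le_trans Ez); apply: ndG; rewrite ltW// (lt_le_trans zx)// subrKC.
by move/le_trans; apply; exact: ndG.
Unshelve. all: by end_near. Qed.

(** For [0 < u < m], take [y := quantile m G u] in the Galois connection: [u <= G y <= G' y]. *)
Lemma quantile_anti m G G' u : mass_cdf m G -> mass_cdf m G' ->
  (forall y, G y <= G' y) -> quantile m G' u <= quantile m G u.
Proof.
move=> mG mG' GG'; have [u0m|/negbTE u0m] := boolP (0 < u < m).
  by rewrite quantile_le// (le_trans _ (GG' _))// -(quantile_le _ mG).
by rewrite /quantile u0m.
Qed.

Lemma measurable_quantile m G : mass_cdf m G ->
  measurable_fun [set: R] (quantile m G).
Proof.
move=> mG; apply: (measurability _ (RGenOInfty.measurableE R)) => //.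
move=> _ [_ [y ->] <-]; rewrite setTI.
(* For [0 < u < m] the Galois connection turns [y < quantile m G u] into [G y < u]; elsewhere the
   value 0 exceeds [y] exactly when [y < 0]. *)
have -> : quantile m G @^-1` `]y, +oo[ =
    (`]0, m[ `&` `]G y, +oo[) `|` (~` `]0, m[ `&` [set _ | y < 0]).
  apply/seteqP; split => u /=; rewrite !in_itv/= !andbT.
    have [u0m|/negbTE u0m] := boolP (0 < u < m).
      by rewrite ltNge quantile_le// -ltNge; left.
    by rewrite /quantile u0m; right.
  case=> -[].
    by move=> u0m; rewrite !ltNge quantile_le.
  by move/negP/negbTE; rewrite /quantile => ->.
apply: measurableU; apply: measurableI => //; first exact: measurableC.
have [y0|y0] := boolP (y < 0).
  by rewrite (_ : [set _ | _] = setT)//; apply/seteqP; split.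
by rewrite (_ : [set _ | _] = set0)//; apply/seteqP; split.
Qed.

(** Inverse transform sampling on a block of length [m]: the Galois connection turns the event into
    [u - a <= G y]. The shift [a] will be 0 for the first block and [p] for the second. *)
Lemma lebesgue_quantile a m G y : mass_cdf m G ->
  lebesgue_measure ([set u | quantile m G (u - a) <= y] `&` `]a, a + m[%classic)
  = (G y)%:E.
Proof.
move=> mG; have G0 := mass_cdf_ge0 y mG; have := mass_cdf_le y mG.
(* The block is open at [a + m], so [G y = m] gives the whole block, and [G y < m] gives []a, a + G
   y]]. *)
rewrite le_eqVlt => /predU1P[Gm|Gm].
  rewrite (_ : _ `&` _ = `]a, a + m[%classic).
    rewrite lebesgue_measure_itv/= lte_fin ltrDl -EFinB addrC addKr -Gm.
    by move: G0; rewrite le_eqVlt => /predU1P[<-|->]; rewrite ?ltxx.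
  apply/seteqP; split => u /=; first by case.
  rewrite in_itv/= => /andP[au um]; split => //; last by rewrite au.
  by rewrite quantile_le//; [rewrite Gm|]; lra.
rewrite (_ : _ `&` _ = `]a, a + G y]%classic).
  rewrite lebesgue_measure_itv/= lte_fin ltrDl -EFinB addrC addKr.
  by move: G0; rewrite le_eqVlt => /predU1P[<-|->]; rewrite ?ltxx.
apply/seteqP; split => u /=; rewrite !in_itv/=.
  case=> + /andP[au um]; rewrite quantile_le//; lra.
move=> /andP[au uG]; split; last lra.
by rewrite quantile_le//; lra.
Qed.

End quantile.

(** * Finite measures on the line that agree on rays *)

Section finite_measure_rays.
Context {R : realType}.

(** The open right rays form a generating pi-system that covers the line. Finiteness allows the
    measure of such a ray to be computed as the total mass minus that of the complementary closed
    ray. *)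
Lemma finite_measure_eq_rays
    (m1 m2 : {measure set R -> \bar R}) :
    m1 setT = m2 setT -> (m1 setT < +oo)%E ->
    (forall y : R, m1 `]-oo, y]%classic = m2 `]-oo, y]%classic) ->
  forall A, measurable A -> m1 A = m2 A.
Proof.
move=> m12T m1oo m12 A mA.
have fin1 B : measurable B -> (m1 B < +oo)%E.
  by move=> mB; rewrite (le_lt_trans _ m1oo)//; apply: le_measure; rewrite ?inE.
apply: (@measure_unique _ R R (@RGenOInfty.G R)
  (fun n => `]- n%:R, +oo[%classic)) => //.
- exact: RGenOInfty.measurableE.
- move=> _ _ [x ->] [y ->]; exists (Num.max x y); apply/seteqP; split => z /=.
    by rewrite !in_itv/= !andbT gt_max => -[-> ->].
  by rewrite !in_itv/= !andbT gt_max => /andP[].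
- by move=> n; exists (- n%:R).
- rewrite -subTset => x _; exists (Num.bound x) => //=.
  by rewrite in_itv/= andbT ltrNl unstable.ltrNbound.
- move=> _ [x ->].
  have rayC (m : {measure set R -> \bar R}) :
      (m setT < +oo)%E ->
      m `]x, +oo[%classic = (m setT - m `]-oo, x]%classic)%E.
    by move=> moo; rewrite -setCitvl -setTD measureD// setTI.
  by rewrite !rayC -?m12T// m12.
- by move=> n; exact: fin1.
Qed.

End finite_measure_rays.

(** * The coupling on two blocks of the unit interval *)

Section comonotone_coupling.
Context {R : realType}.

Lemma lebesgue_measure_itvoo (a b : R) : a <= b ->
  lebesgue_measure `]a, b[%classic = (b - a)%:E.
Proof.
rewrite lebesgue_measure_itv/= lte_fin.
by rewrite le_eqVlt => /predU1P[->|->]; rewrite ?ltxx ?subrr.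
Qed.

(* For [p = P(D = 0)] the event [D = 0] is modelled by [`]0, p[] and the event
   [D = 1] by [`]p, 1[]. *)
Lemma lebesgue_two_blocks (p : R) : 0 <= p <= 1 ->
  exists P : probability (measurableTypeR R) R, forall A : set R,
    P A = (lebesgue_measure (A `&` `]0%R, p[%classic)
           + lebesgue_measure (A `&` `]p, 1%R[%classic))%E.
Proof.
move=> /andP[p0 p1].
pose mu : {measure set (measurableTypeR R) -> \bar R} := measure_add
  (mrestr (@lebesgue_measure R) (measurable_itv `]0, p[))
  (mrestr (@lebesgue_measure R) (measurable_itv `]p, 1[)).
have muE (A : set R) : mu A = (lebesgue_measure (A `&` `]0%R, p[%classic)
           + lebesgue_measure (A `&` `]p, 1%R[%classic))%E.
  exact: measure_addE.
have muT : mu setT = 1%E.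
  by rewrite muE !setTI !lebesgue_measure_itvoo// subr0 -EFinD subrKC.
exists (HB.pack_for (probability (measurableTypeR R) R) (Measure.sort mu)
  (Measure_isProbability.Build _ (measurableTypeR R) R (Measure.sort mu) muT)).
exact: muE.
Qed.

(** Both outcomes are quantile functions evaluated at the same point, so comparing the distribution
    functions orders the outcomes at every point, not just almost surely. If [p] is 0 or 1, one
    block is empty. *)
Lemma comonotone_coupling (p : R) (G0 K0 G1 K1 : R -> R) :
    0 <= p <= 1 ->
    mass_cdf p G0 -> mass_cdf p K1 -> mass_cdf (1 - p) G1 ->
    mass_cdf (1 - p) K0 ->
    (forall y, G0 y <= K1 y) -> (forall y, G1 y <= K0 y) ->
  exists (P : probability (measurableTypeR R) R) (D Y0 Y1 : {RV P >-> R}),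
    [/\ forall x, D x = 0 \/ D x = 1,
        P [set x | D x = 0] = p%:E /\ P [set x | D x = 1] = (1 - p)%:E,
        forall y, P [set x | Y0 x <= y /\ D x = 0] = (G0 y)%:E /\
                  P [set x | Y0 x <= y /\ D x = 1] = (K0 y)%:E,
        forall y, P [set x | Y1 x <= y /\ D x = 0] = (K1 y)%:E /\
                  P [set x | Y1 x <= y /\ D x = 1] = (G1 y)%:E &
        forall x, (Y0 x < Y1 x -> D x = 1) /\ (Y1 x < Y0 x -> D x = 0)].
Proof.
move=> p01 mG0 mK1 mG1 mK0 GK0 GK1; have [P PE] := lebesgue_two_blocks p01.
case/andP: p01 => p0 p1.
(* [A] governs the first block and [B] the second, translated to start at 0. Points outside both
   blocks carry no mass, and every [glue A B] is 0 there. *)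
pose glue (A B : R -> R) (u : measurableTypeR R) : R :=
  if u < p then quantile p A u else quantile (1 - p) B (u - p).
pose d (u : measurableTypeR R) : R := if u < p then 0 else 1.
have mltp : measurable_fun [set: measurableTypeR R] (fun u => u < p).
  by apply: measurable_fun_ltr; [exact: measurable_id|exact: measurable_cst].
have mglue A B : mass_cdf p A -> mass_cdf (1 - p) B ->
    measurable_fun setT (glue A B).
  move=> mA mB; apply: measurable_fun_ifT => //.
    exact: measurable_quantile.
  apply: (measurableT_comp (measurable_quantile mB)).
  by apply: measurable_funB; [exact: measurable_id|exact: measurable_cst].
have md : measurable_fun setT d.
  by apply: measurable_fun_ifT => //; exact: measurable_cst.
have d0 (E : set R) :
    P [set u | E u /\ d u = 0] = lebesgue_measure (E `&` `]0%R, p[%classic).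
  rewrite PE [X in (_ + lebesgue_measure X)%E](_ : _ = set0); last first.
    rewrite -subset0 => u [[_ +]] /=; rewrite in_itv/= => + /andP[pu _].
    by rewrite /d ltNge (ltW pu)/= => /eqP; rewrite oner_eq0.
  rewrite measure0 adde0; congr (lebesgue_measure _).
  apply/seteqP; split => u /=; rewrite in_itv/= => -[]; first by case.
  by move=> Eu /andP[u0 up]; split; [split => //; rewrite /d up|rewrite u0].
have d1 (E : set R) :
    P [set u | E u /\ d u = 1] = lebesgue_measure (E `&` `]p, 1%R[%classic).
  rewrite PE [X in (lebesgue_measure X + _)%E](_ : _ = set0); last first.
    rewrite -subset0 => u [[_ +]] /=; rewrite in_itv/= => + /andP[_ up].
    by rewrite /d up => /esym/eqP; rewrite oner_eq0.
  rewrite measure0 add0e; congr (lebesgue_measure _).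
  apply/seteqP; split => u /=; rewrite in_itv/= => -[]; first by case.
  move=> Eu /andP[up u1]; split; last by rewrite up.
  by split => //; rewrite /d ltNge (ltW up).
have glue0 A B y : mass_cdf p A ->
    P [set u | glue A B u <= y /\ d u = 0] = (A y)%:E.
  move=> mA; rewrite (d0 [set u | glue A B u <= y]).
  rewrite -(lebesgue_quantile 0 y mA) add0r; congr (lebesgue_measure _).
  by apply/seteqP; split => u /=; rewrite in_itv/= subr0 => -[] + /andP[u0 up];
    rewrite /glue up u0 => ?; split.
have glue1 A B y : mass_cdf (1 - p) B ->
    P [set u | glue A B u <= y /\ d u = 1] = (B y)%:E.
  move=> mB; rewrite (d1 [set u | glue A B u <= y]).
  rewrite -(lebesgue_quantile p y mB) subrKC; congr (lebesgue_measure _).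
  by apply/seteqP; split => u /=; rewrite in_itv/= => -[] + /andP[up u1];
    rewrite /glue ltNge (ltW up)/= up u1 => ?; split.
exists P, (mfun_Sub (mem_set md)), (mfun_Sub (mem_set (mglue _ _ mG0 mK0))),
  (mfun_Sub (mem_set (mglue _ _ mK1 mG1))); split => /=.
- by move=> x; rewrite /d; case: ifP; [left|right].
- split.
    have := d0 setT; rewrite setTI.
    rewrite (_ : [set u | _ /\ _] = [set u | d u = 0]) => [->|].
      by rewrite lebesgue_measure_itvoo// subr0.
    by apply/seteqP; split => u//= -[].
  have := d1 setT; rewrite setTI.
  rewrite (_ : [set u | _ /\ _] = [set u | d u = 1]) => [->|].
    by rewrite lebesgue_measure_itvoo.
  by apply/seteqP; split => u//= -[].
- by move=> y; split; [exact: glue0|exact: glue1].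
- by move=> y; split; [exact: glue0|exact: glue1].
- move=> x; rewrite /glue /d; case: ifP => _; split => //.
    by rewrite ltNge quantile_anti.
  by rewrite ltNge quantile_anti.
Qed.

End comonotone_coupling.

(** * The joint law of [Y] and [D], and the inequality (star) *)

Section random_variable_events.
Context {R : realType} d {T : measurableType d} {P : probability T R}.
Implicit Types X Y Z D : {RV P >-> R}.

Lemma measurable_eq_event D (b : R) : measurable [set x | D x = b].
Proof. exact: (@measurable_funPTI _ _ _ _ D [set b]). Qed.

Lemma measurable_le_event X (y : \bar R) :
  measurable [set x | ((X x)%:E <= y)%E].
Proof.
case: y => [r| |].
- rewrite (_ : [set x | _] = X @^-1` `]-oo, r]); first exact: measurable_funPTI.
  by apply/seteqP; split => x /=; rewrite in_itv/= lee_fin.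
- rewrite (_ : [set x | _] = setT)//.
  by apply/seteqP; split => x //= _; rewrite leey.
- by rewrite (_ : [set x | _] = set0)//; apply/seteqP; split.
Qed.

Lemma cdfE X (r : R) : cdf X r = P [set x | X x <= r].
Proof. by []. Qed.

(** The limits 1 and 0 at the infinities are the probabilities of the whole space and of the empty
    event, so one formula covers all three cases of [Fext]. *)
Lemma Fext_cdf X (y : \bar R) :
  Fext (cdf X) y = P [set x | ((X x)%:E <= y)%E].
Proof.
case: y => [r| |] /=.
- exact: cdfE.
- rewrite (cvg_lim _ (cvg_cdfy1 X))// (_ : [set x | _] = setT) ?probability_setT//.
  by apply/seteqP; split => x //= _; rewrite leey.
- rewrite (cvg_lim _ (cvg_cdfNy0 X))// (_ : [set x | _] = set0) ?measure0//.
  by apply/seteqP; split.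
Qed.

(** Direction (1) for both values of [d] at once, with [Z] in the role of [Y_d]. Since [b != 1 - b],
    the two events in (star) are disjoint and their probabilities add. *)
Lemma ineq_star_cdf Z Y D (b : R) :
    b != 1 - b -> (forall x, D x = b -> Y x = Z x) ->
    {ae P, forall x, D x = 1 - b -> Z x <= Y x} ->
  forall y1 y2 : \bar R, (y1 < y2)%E -> ineq_star P Y D b (cdf Z) y1 y2.
Proof.
move=> bNb YZ [N [mN N0 subN]] y1 y2 y12.
rewrite /ineq_star !Fext_cdf.
set B := [set x | ((Z x)%:E <= y2)%E]; set A := [set x | ((Z x)%:E <= y1)%E].
set E := [set x | _ /\ _ /\ _]; set E' := [set x | _ /\ D x = 1 - b].
have mB : measurable B by exact: measurable_le_event.
have mA : measurable A by exact: measurable_le_event.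
have AB : A `<=` B by move=> x /le_trans; apply; exact: ltW.
have mE' : measurable E'.
  by apply: measurableI; [exact: measurable_le_event|exact: measurable_eq_event].
have mE : measurable E.
  rewrite (_ : E = (~` [set x | ((Y x)%:E <= y1)%E]) `&`
    ([set x | ((Y x)%:E <= y2)%E] `&` [set x | D x = b])).
    apply: measurableI; first by apply: measurableC; exact: measurable_le_event.
    by apply: measurableI; [exact: measurable_le_event|exact: measurable_eq_event].
  apply/seteqP; split => x /= -[].
    by move=> y1Y ?; split => //; apply/negP; rewrite -ltNge.
  by move/negP; rewrite -ltNge.
have EAB : E `<=` B `\` A.
  by move=> x; rewrite /E/B/A/= => -[y1Y [Yy2 /YZ YZx]]; rewrite -YZx; split => //;
    apply/negP; rewrite -ltNge.
have <- : P (B `\` A) = (P B - P A)%E.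
  by rewrite measureD ?setIidr// ltey_eq fin_num_measure.
have mBA : measurable (B `\` A) by exact: measurableD.
have [y1oo|y1oo] := eqVneq y1 -oo%E; last first.
  by rewrite mul0e adde0; apply: le_measure; rewrite ?inE.
rewrite mul1e -measureU//; last first.
  apply/seteqP; split => // x [[_ [_ Db]] [_ Db']].
  by move: bNb; rewrite -Db' Db eqxx.
(* Adding the null set [N] of exceptional points turns the almost sure inclusion into a genuine
   one. *)
rewrite -(measureU0 mBA mN N0); apply: le_measure; rewrite ?inE.
- exact: measurableU.
- exact: measurableU.
- move=> x [/EAB|[/= Yy2 Db]]; first by left.
  have [Nx|Nx] := pselect (N x); [by right|left].
  have ZY : Z x <= Y x.
    by apply: contrapT => ZY; apply: Nx; apply: subN => /(_ Db).
  split; first by rewrite /B/= (le_trans _ Yy2)// lee_fin.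
  by rewrite /A/= y1oo.
Qed.

(** The function [J_b], made real-valued so that [F - J_b] is a subtraction of real functions. *)
Definition joint_cdf Y D (b y : R) := fine (P [set x | Y x <= y /\ D x = b]).

Lemma measurable_joint_event Y D (b y : R) :
  measurable [set x | Y x <= y /\ D x = b].
Proof.
apply: measurableI; last exact: measurable_eq_event.
exact: (measurable_le_event Y y%:E).
Qed.

Lemma joint_cdfE Y D (b y : R) :
  P [set x | Y x <= y /\ D x = b] = (joint_cdf Y D b y)%:E.
Proof. by rewrite fineK// fin_num_measure//; exact: measurable_joint_event. Qed.

(** What is left of [B] after removing [A] is only made smaller by intersecting with [C]. *)
Lemma fine_probability_setI_incr (A B C : set T) :
    measurable A -> measurable B -> measurable C -> A `<=` B ->
  0 <= fine (P (B `&` C)) - fine (P (A `&` C)) <= fine (P B) - fine (P A).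
Proof.
move=> mA mB mC AB.
have fineD (U V : set T) : measurable U -> measurable V -> U `<=` V ->
    fine (P V) - fine (P U) = fine (P (V `\` U)).
  move=> mU mV UV; rewrite measureD ?setIidr//.
    by rewrite fineB// fin_num_measure.
  by rewrite ltey_eq fin_num_measure.
have mAC := measurableI _ _ mA mC; have mBC := measurableI _ _ mB mC.
rewrite !fineD//; last exact: setSI.
rewrite fine_ge0//= fine_le ?fin_num_measure//; try exact: measurableD.
apply: le_measure; rewrite ?inE; try exact: measurableD.
by move=> x [[Bx Cx] nAC]; split => // Ax; apply: nAC.
Qed.

Lemma joint_cdf_incr Y D (b y z : R) : y <= z ->
  0 <= joint_cdf Y D b z - joint_cdf Y D b y
    <= fine (cdf Y z) - fine (cdf Y y).
Proof.
move=> yz; rewrite !cdfE; apply: fine_probability_setI_incr.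
- exact: (measurable_le_event Y y%:E).
- exact: (measurable_le_event Y z%:E).
- exact: measurable_eq_event.
- by move=> x /le_trans; apply.
Qed.

(** The increments of [J_b] are squeezed between 0 and those of the distribution function of [Y], so
    right continuity and the limits are inherited from the latter. *)
Lemma mass_cdf_joint_cdf Y D (b : R) :
  mass_cdf (fine (P [set x | D x = b])) (joint_cdf Y D b).
Proof.
split.
- by move=> y z /(joint_cdf_incr Y D b); rewrite subr_ge0 => /andP[].
- move=> y.
  have cY : fine (cdf Y z) @[z --> y^'+] --> fine (cdf Y y).
    apply: fine_cvg; rewrite fineK ?fin_num_measure//.
    exact: cdf_right_continuous.
  apply: (@squeeze_cvgr _ _ _ _ (fun=> joint_cdf Y D b y)
    (fun z => joint_cdf Y D b y + (fine (cdf Y z) - fine (cdf Y y)))).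
  + near=> z; have /(joint_cdf_incr Y D b) : y <= z.
      by near: z; exact: nbhs_right_ge.
    lra.
  + exact: cvg_cst.
  + rewrite -[X in _ --> X]addr0 -(subrr (fine (cdf Y y))).
    by apply: cvgD; [exact: cvg_cst|apply: cvgB => //; exact: cvg_cst].
- have cY := fine_cvg (cvg_cdfNy0 Y).
  apply: (@squeeze_cvgr _ _ _ _ (fun=> 0) (fine \o cdf Y)).
  + near=> y; rewrite fine_ge0//= /joint_cdf/= fine_le ?fin_num_measure//.
    * exact: measurable_joint_event.
    * rewrite cdfE; apply: le_measure; rewrite ?inE; last by move=> x [].
        exact: measurable_joint_event.
      exact: (measurable_le_event Y y%:E).
  + exact: cvg_cst.
  + exact: cY.
- have cY := fine_cvg (cvg_cdfy1 Y).
  apply: (@squeeze_cvgr _ _ _ _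
    (fun y => fine (P [set x | D x = b]) - (1 - fine (cdf Y y)))
    (fun=> fine (P [set x | D x = b]))).
  + near=> y.
    (* The increment from [Y <= y] to the whole space: [P(D = b) - J_b y] is at most
       [1 - P(Y <= y)]. *)
    have := @fine_probability_setI_incr [set x | Y x <= y] setT [set x | D x = b]
      (measurable_le_event Y y%:E) measurableT (measurable_eq_event _ _)
      (fun _ _ => I).
    rewrite setTI probability_setT/= -cdfE -/(joint_cdf Y D b y).
    lra.
  + rewrite -[X in _ --> X]subr0 -(subrr (1 : R)).
    by apply: cvgB; [exact: cvg_cst|apply: cvgB; [exact: cvg_cst|exact: cY]].
  + exact: cvg_cst.
Unshelve. all: by end_near. Qed.

Lemma ineq_star_incr Y D (b y z : R) (F : R -> R) : y <= z ->
    ineq_star P Y D b (fun r => (F r)%:E) y%:E z%:E ->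
  joint_cdf Y D b z - joint_cdf Y D b y <= F z - F y.
Proof.
move=> yz; rewrite /ineq_star /= mul0e adde0 -EFinB.
have mJ := measurable_joint_event Y D b.
rewrite (_ : [set x | _] =
    [set x | Y x <= z /\ D x = b] `\` [set x | Y x <= y /\ D x = b]).
  have -> : P ([set x | Y x <= z /\ D x = b] `\` [set x | Y x <= y /\ D x = b]) =
      (P [set x | (Y x <= z)%R /\ D x = b] -
       P [set x | (Y x <= y)%R /\ D x = b])%E.
    rewrite measureD ?setIidr// ?ltey_eq ?fin_num_measure//.
    by move=> x [/le_trans/(_ yz)].
  by rewrite !joint_cdfE -EFinB lee_fin.
apply/seteqP; split => x /=; rewrite lte_fin lee_fin.
  by move=> [yY [Yz Db]]; split => // -[]; rewrite leNgt yY.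
move=> [[Yz Db] nYy]; split => //; rewrite ltNge; apply/negP => Yy.
exact: nYy.
Qed.

(** The limit 0 of [F] removes the subtracted term in (star). Moving [J_b] to the other side then
    gives the comparison [J_(1 - b) <= K_b] used by the coupling. *)
Lemma ineq_star_Ny Y D (b y : R) (F : R -> R) : F @ -oo --> (0 : R) ->
    ineq_star P Y D b (fun r => (F r)%:E) -oo%E y%:E ->
  joint_cdf Y D b y + joint_cdf Y D (1 - b) y <= F y.
Proof.
move=> F0; rewrite /ineq_star /= mul1e.
have -> : lim ((F x)%:E @[x --> -oo]) = 0%E.
  by apply: cvg_lim => //; apply: cvg_EFin => //; exact: nearW.
rewrite (_ : [set x | _] = [set x | Y x <= y /\ D x = b]).
  rewrite (_ : [set x | (_ <= _)%E /\ _] = [set x | Y x <= y /\ D x = 1 - b]).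
    by rewrite !joint_cdfE sube0 -EFinD lee_fin.
  by apply/seteqP; split => x /=; rewrite lee_fin.
apply/seteqP; split => x /=; rewrite lee_fin; first by case.
by move=> YD; split => //; exact: ltNyr.
Qed.

(** Right continuity and the limits pass to the difference [K_b]; its monotonicity is the hypothesis
    on increments, which comes from (star). *)
Lemma mass_cdf_residual Y D (b : R) (F : R -> R) :
    right_continuous F -> F @ -oo --> (0 : R) -> F @ +oo --> (1 : R) ->
    (forall y z : R, y <= z ->
      joint_cdf Y D b z - joint_cdf Y D b y <= F z - F y) ->
  mass_cdf (1 - fine (P [set x | D x = b])) (fun y => F y - joint_cdf Y D b y).
Proof.
move=> rcF F0 F1 incrF.
have [_ rcJ J0 J1] := mass_cdf_joint_cdf Y D b; split.
- by move=> y z /incrF; lra.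
- by move=> y; apply: cvgB.
- by rewrite -[X in _ --> X](subrr (0 : R)); apply: cvgB.
- exact: cvgB.
Qed.

(** For fixed [b], the map from [A] to [P(Y in A, D = b)] is a finite measure, the image under [Y]
    of [P] restricted to [D = b]; its total mass and its values on rays determine it. *)
Lemma joint_law_eq d' (T' : measurableType d') (P' : probability T' R)
    Y D (Y' D' : {RV P' >-> R}) (b : R) :
    P' [set x | D' x = b] = P [set x | D x = b] ->
    (forall y, P' [set x | Y' x <= y /\ D' x = b] =
               P [set x | Y x <= y /\ D x = b]) ->
  forall A : set R, measurable A ->
    P' [set x | A (Y' x) /\ D' x = b] = P [set x | A (Y x) /\ D x = b].
Proof.
move=> PD PY A mA.
have mD : measurable (D @^-1` [set b]) by exact: measurable_funPTI.
have mD' : measurable (D' @^-1` [set b]) by exact: measurable_funPTI.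
pose law d0 (T0 : measurableType d0) (m : {measure set T0 -> \bar R})
    (X : {mfun T0 >-> R}) :=
  measure_function_pushforward__canonical__measure_function_Measure
    m (measurable_funPT X).
pose m1 := law _ _ (mrestr P' mD') Y'; pose m2 := law _ _ (mrestr P mD) Y.
rewrite -[LHS]/(m1 A) -[RHS]/(m2 A); apply: finite_measure_eq_rays => //.
- by rewrite /m1 /m2/= /pushforward /mrestr !preimage_setT !setTI.
- rewrite /m1/= /pushforward /mrestr preimage_setT setTI ltey_eq.
  by rewrite fin_num_measure.
Qed.

End random_variable_events.

(** * The two directions of the theorem *)

Unset Implicit Arguments.

Theorem theorem4 (R : realType) :
  (* (1) *)
  (forall (dT : measure_display) (T : measurableType dT) (P : probability T R)
     (Y0 Y1 Y D : {RV P >-> R}),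
     (forall x, D x = 0 \/ D x = 1) ->
     (forall x, Y x = Y1 x * D x + Y0 x * (1 - D x)) ->
     {ae P, forall x, (Y0 x < Y1 x -> D x = 1) /\ (Y1 x < Y0 x -> D x = 0)} ->
     forall (dd : R), (dd = 0 \/ dd = 1) ->
     forall y1 y2 : \bar R, (y1 < y2)%E ->
       ineq_star P Y D dd (cdf (if dd == 0 then Y0 else Y1)) y1 y2)
  /\
  (* (2) *)
  (forall (dT : measure_display) (T : measurableType dT) (P : probability T R)
     (Y D : {RV P >-> R}) (F0 F1 : R -> R),
     (forall x, D x = 0 \/ D x = 1) ->
     right_continuous F0 -> right_continuous F1 ->
     F0 @ -oo --> (0 : R) -> F0 @ +oo --> (1 : R) ->
     F1 @ -oo --> (0 : R) -> F1 @ +oo --> (1 : R) ->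
     (forall (dd : R), (dd = 0 \/ dd = 1) ->
       forall y1 y2 : \bar R, (y1 < y2)%E ->
         ineq_star P Y D dd
           (fun r => (if dd == 0 then F0 r else F1 r)%:E) y1 y2) ->
     exists (dT' : measure_display) (T' : measurableType dT')
            (P' : probability T' R) (Yt Dt Y0 Y1 : {RV P' >-> R}),
       (forall x, Dt x = 0 \/ Dt x = 1) /\
       (forall (A : set R), measurable A -> forall b : R,
          P' [set x | A (Yt x) /\ Dt x = b] = P [set x | A (Y x) /\ D x = b]) /\
       (forall y, cdf Y0 y = (F0 y)%:E) /\
       (forall y, cdf Y1 y = (F1 y)%:E) /\
       (forall x, Yt x = Y1 x * Dt x + Y0 x * (1 - Dt x)) /\
       {ae P', forall x, (Y0 x < Y1 x -> Dt x = 1) /\ (Y1 x < Y0 x -> Dt x = 0)}).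
Proof.
split.
  move=> dT T P Y0 Y1 Y D D01 YE aeY b b01; apply: ineq_star_cdf.
  - by case: b01 => ->; rewrite ?subr0 ?subrr ?oner_neq0// eq_sym oner_neq0.
  - by case: b01 => -> x Dx; rewrite ?eqxx ?oner_eq0 YE Dx; lra.
  - apply: filterS aeY => x [Y01 Y10] Dx.
    (* On [D = 1 - b] the observed [Y] is the other outcome. If [Y_b] exceeded it, the selection
       rule would force [D = b]. *)
    case: b01 => bE; rewrite bE ?eqxx ?oner_eq0 in Dx *; rewrite YE Dx.
      rewrite leNgt; apply/negP => YY; suff : D x = 0 by lra.
      by apply: Y10; lra.
    rewrite leNgt; apply/negP => YY; suff : D x = 1 by lra.
    by apply: Y01; lra.
move=> dT T P Y D F0 F1 D01 rc0 rc1 F0N F0y F1N F1y star.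
have star0 := star 0 (or_introl erefl); have star1 := star 1 (or_intror erefl).
rewrite eqxx in star0; rewrite oner_eq0 in star1.
pose p := fine (P [set x | D x = 0]).
have mD b := measurable_eq_event D b.
have pE : P [set x | D x = 0] = p%:E by rewrite fineK// fin_num_measure.
have qE : P [set x | D x = 1] = (1 - p)%:E.
  rewrite EFinB -pE -probability_setC//; congr (P _).
  apply/seteqP; split => x /=; first by move=> ->; apply/eqP; rewrite oner_eq0.
  by case: (D01 x).
have p01 : 0 <= p <= 1.
  by rewrite -!lee_fin -pE measure_ge0 probability_le1.
have leW (F : R -> R) b :
    (forall y z : \bar R, (y < z)%E -> ineq_star P Y D b (fun r => (F r)%:E) y z) ->
    forall y z : R, y <= z -> joint_cdf Y D b z - joint_cdf Y D b y <= F z - F y.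
  move=> sF y z; rewrite le_eqVlt => /predU1P[->|yz]; first by rewrite !subrr.
  by apply: (ineq_star_incr (ltW yz)); apply: sF; rewrite lte_fin.
have mG0 : mass_cdf p (joint_cdf Y D 0) := mass_cdf_joint_cdf Y D 0.
have mG1 : mass_cdf (1 - p) (joint_cdf Y D 1).
  by have := mass_cdf_joint_cdf Y D 1; rewrite qE.
have mK0 : mass_cdf (1 - p) (fun y => F0 y - joint_cdf Y D 0 y).
  by apply: mass_cdf_residual => //; exact: leW.
(* The mass of [K_1] is [1 - P(D = 1) = p], the length of the block [D = 0]. *)
have mK1 : mass_cdf p (fun y => F1 y - joint_cdf Y D 1 y).
  have := @mass_cdf_residual _ _ _ P Y D 1 F1 rc1 F1N F1y (leW _ _ star1).
  by rewrite qE/= subKr.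
(* The comparison on the block [D = 0] comes from (star) for [d = 1], and the one on [D = 1] from
   (star) for [d = 0]. *)
have GK0 y : joint_cdf Y D 0 y <= F1 y - joint_cdf Y D 1 y.
  have := ineq_star_Ny F1N (star1 -oo%E y%:E (ltNyr y)); rewrite subrr; lra.
have GK1 y : joint_cdf Y D 1 y <= F0 y - joint_cdf Y D 0 y.
  have := ineq_star_Ny F0N (star0 -oo%E y%:E (ltNyr y)); rewrite subr0; lra.
have [P' [D' [Y0 [Y1 [D'01 [P'0 P'1] PY0 PY1 mono]]]]] :=
  comonotone_coupling p01 mG0 mK1 mG1 mK0 GK0 GK1.
have mYt : measurable_fun setT (fun x => Y1 x * D' x + Y0 x * (1 - D' x)).
  apply: measurable_funD; apply: measurable_funM => //.
  by apply: measurable_funB => //; exact: measurable_cst.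
have [Yt YtE] : exists Yt : {RV P' >-> R},
    forall x, Yt x = Y1 x * D' x + Y0 x * (1 - D' x).
  by exists (mfun_Sub (mem_set mYt)).
have Yt0 x : D' x = 0 -> Yt x = Y0 x by rewrite YtE => ->; lra.
have Yt1 x : D' x = 1 -> Yt x = Y1 x by rewrite YtE => ->; lra.
(* Splitting along the two blocks, so that [J_d + K_d = F_d] will give the marginals. *)
have cdfD (X : {RV P' >-> R}) y : cdf X y =
    (P' [set x | (X x <= y)%R /\ D' x = 0%R] +
     P' [set x | (X x <= y)%R /\ D' x = 1%R])%E.
  have mJ := measurable_joint_event X D'.
  rewrite cdfE -measureU//; last first.
    apply/seteqP; split => // x [[_ D0] [_ /eqP]].
    by rewrite D0 eq_sym oner_eq0.
  congr (P' _); apply/seteqP; split => x /=; last by case=> -[].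
  by case: (D'01 x); [left|right].
exists _, (measurableTypeR R), P', Yt, D', Y0, Y1; split; first exact: D'01.
split.
  move=> A mA b; have [->|b0] := eqVneq b 0.
    apply: joint_law_eq => // [|y]; first by rewrite P'0 pE.
    rewrite [RHS]joint_cdfE -(PY0 y).1; congr (P' _).
    by apply/seteqP; split => x /= [] + Dx; rewrite Yt0.
  have [->|b1] := eqVneq b 1.
    apply: joint_law_eq => // [|y]; first by rewrite P'1 qE.
    rewrite [RHS]joint_cdfE -(PY1 y).2; congr (P' _).
    by apply/seteqP; split => x /= [] + Dx; rewrite Yt1.
  (* For [b] other than 0 and 1 both events are empty. *)
  have D'b : [set x | A (Yt x) /\ D' x = b] = set0.
    rewrite -subset0 => x [_ Dx].
    by case: (D'01 x) => DE; move: b0 b1; rewrite -Dx DE eqxx.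
  have Db : [set x | A (Y x) /\ D x = b] = set0.
    rewrite -subset0 => x [_ Dx].
    by case: (D01 x) => DE; move: b0 b1; rewrite -Dx DE eqxx.
  by rewrite D'b Db !measure0.
split; first by move=> y; rewrite cdfD (PY0 y).1 (PY0 y).2 -EFinD subrKC.
split; first by move=> y; rewrite cdfD (PY1 y).1 (PY1 y).2 -EFinD subrK.
split; first exact: YtE.
exact: aeW.
Qed.
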